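(* Let $k\geq 2$ and let $B_k$ be the generalized Bethe tree with $k$ levels in which the degrees of the vertices at levels $1,2,\ldots,k$ are $d_1,d_2,\ldots,d_{k-1},d_k=1$, respectively. Let $p$ be a positive real number. Then $$A_p(B_k)=d_1^{\frac{1}{p}}\left(|d_1-d_2|^p+\sum_{i=2}^{k-1}|d_i-d_{i+1}|^p\prod_{j=2}^{i}(d_j-1)\right)^{\frac{1}{p}}.$$
   Context: For a positive real number $p$, the general Albertson irregularity index of a connected graph $G$ is $A_p(G)=\left(\sum_{uv\in E(G)}|d(u)-d(v)|^p\right)^{1/p}$, where $d(v)$ is the degree of $v$. A generalized Bethe tree is a rooted tree in which vertices of the same level have the same degree; $B_k$ denotes a generalized Bethe tree with $k$ levels, with the root at level $1$. *)

(* Defs.v *)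
From mathcomp Require Import all_boot all_order all_algebra.
From mathcomp Require Import reals exp.

Set Implicit Arguments.
Unset Strict Implicit.
Unset Printing Implicit Defensive.

Import Order.TTheory GRing.Theory Num.Theory.
Local Open Scope ring_scope.

Definition simple_graph (T : finType) (e : rel T) : Prop :=
  symmetric e /\ irreflexive e.

Definition deg (T : finType) (e : rel T) (v : T) : nat := #|[set w | e v w]|.

(* Each undirected edge {u, v} is represented exactly once, by the pair whose
   first component comes first in the enumeration of T. *)
Definition edges (T : finType) (e : rel T) : {set T * T} :=
  [set uv | e uv.1 uv.2 & (enum_rank uv.1 < enum_rank uv.2)%N].

Definition albertson_index (R : realType) (T : finType) (e : rel T) (p : R)
  : R :=
  (\sum_(uv in edges e) `|(deg e uv.1)%:R - (deg e uv.2)%:R| `^ p) `^ (1 / p).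

Definition connected_graph (T : finType) (e : rel T) : Prop :=
  forall x y : T, connect e x y.

(* The bound 2 discards the back-and-forth closed walk x, y, x, which [cycle]
   accepts. *)
Definition acyclic_graph (T : finType) (e : rel T) : Prop :=
  forall c : seq T, cycle e c -> uniq c -> (size c <= 2)%N.

Definition tree (T : finType) (e : rel T) : Prop :=
  [/\ simple_graph e, connected_graph e & acyclic_graph e].

(* The least length of a walk from x to y; a shortest walk has fewer than #|T|
   edges, so in a connected graph the search always succeeds. *)
Definition graph_dist (T : finType) (e : rel T) (x y : T) : nat :=
  find (fun n => [exists s : n.-tuple T, path e x s && (last x s == y)])
       (iota 0 #|T|).

Definition tree_level (T : finType) (e : rel T) (r v : T) : nat :=
  (graph_dist e r v).+1.

Definition generalized_bethe_tree (T : finType) (e : rel T) (r : T) (k : nat)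
  : Prop :=
  [/\ tree e,
      forall u v : T, tree_level e r u = tree_level e r v -> deg e u = deg e v
    & (\max_(v : T) tree_level e r v)%N = k].

(* Main.v *)
(* In a tree simple paths are unique, so no edge joins two vertices of the same
   level and every vertex other than the root has exactly one neighbour on the
   previous level. Hence the number of edges between levels i and i+1 is the
   number of vertices of level i+1; each of these has d_(i+1) - 1 children, so
   the edge counts satisfy E_1 = d_1 and E_(i+1) = E_i (d_(i+1) - 1), and every
   edge counted by E_i contributes |d_i - d_(i+1)|^p. *)
Require Import Defs.
From mathcomp Require Import all_boot all_order all_algebra.
From mathcomp Require Import reals exp.

Set Implicit Arguments.
Unset Strict Implicit.
Unset Printing Implicit Defensive.

Import Order.TTheory GRing.Theory Num.Theory.
Local Open Scope ring_scope.

(** * Uniqueness of simple paths in acyclic graphs *)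

(** Following the first path and returning along the second is a closed walk without repetition on
    [size s + size t + 2] vertices, and acyclicity allows at most 2. *)
Lemma acyclic_disjoint_paths (T : finType) (e : rel T) (x z : T) (s t : seq T) :
  symmetric e -> acyclic_graph e ->
  path e x (rcons s z) -> path e x (rcons t z) ->
  uniq (x :: rcons s z) -> uniq (x :: rcons t z) -> ~~ has (mem t) s ->
  s = [::] /\ t = [::].
Proof.
move=> sym_e acy sP tP sU tU st.
have tP' : path e z (rcons (rev t) x).
  rewrite -rev_cons -(belast_rcons x t z).
  rewrite -[z in path e z _](last_rcons x t) rev_path.
  by rewrite (eq_path (e' := e)) // => u v; rewrite sym_e.
have cyc : cycle e (x :: rcons s z ++ rev t).
  by rewrite /= rcons_cat cat_path sP last_rcons.
have U : uniq (x :: rcons s z ++ rev t).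
  move: sU tU; rewrite !cons_uniq cat_uniq !mem_rcons !rcons_uniq !inE.
  rewrite mem_cat mem_rcons !inE mem_rev rev_uniq !negb_or.
  move=> /andP[/andP[xz xs] /andP[zs sU]] /andP[/andP[_ xt] /andP[zt tU]].
  rewrite xz xs xt zs sU tU /= andbT has_rev; apply/hasPn=> u ut.
  rewrite /= mem_rcons inE negb_or; apply/andP; split.
    by apply: contraNneq zt => <-.
  by apply: contraNN st => us; apply/hasP; exists u.
have := acy _ cyc U; rewrite /= size_cat size_rcons size_rev.
by case: s {sP sU st cyc U} => [|? ?]; case: t {tP tU tP'}.
Qed.

Lemma acyclic_uniq_path (T : finType) (e : rel T) (x : T) (s t : seq T) :
  symmetric e -> acyclic_graph e ->
  path e x s -> path e x t -> uniq (x :: s) -> uniq (x :: t) ->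
  last x s = last x t -> s = t.
Proof.
move=> sym_e acy; elim: s x t => [|a s IHs] x [|b t] //.
- by move=> _ _ _ /= /andP[xNt _] xE; rewrite [x in x \in _]xE mem_last in xNt.
- by move=> _ _ /= /andP[xNs _] _ xE; rewrite -xE mem_last in xNs.
have [<-{b}|neq_ab] := eqVneq a b.
  move=> /= /andP[_ sP] /andP[_ tP] /andP[_ sU] /andP[_ tU] lastE.
  by rewrite (IHs a t).
move=> sP tP sU tU /= lastE; exfalso.
(* The two paths leave x by different edges: they close up to a cycle at the
   first vertex z of the first path lying on the second one. *)
have [z [p1 [p2 [q1 [q2 [pE qE disj]]]]]] : exists z p1 p2 q1 q2,
    [/\ a :: s = rcons p1 z ++ p2, b :: t = rcons q1 z ++ q2
      & ~~ has (mem q1) p1].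
  have hasS : has (mem (b :: t)) (a :: s).
    by apply/hasP; exists (last a s); [|rewrite lastE]; apply: mem_last.
  case/split_find: hasS => z p1 p2 zt p1N.
  case/path.splitP: zt p1N => q1 q2 p1N; exists z, p1, p2, q1, q2; split=> //.
  apply: contraNN p1N => /hasP[u up uq]; apply/hasP; exists u => //.
  by rewrite inE mem_cat mem_rcons inE [u \in q1]uq orbT.
move: sP tP sU tU; rewrite pE qE -!cat_cons !cat_path !cat_uniq.
move=> /andP[sP _] /andP[tP _] /andP[sU _] /andP[tU _].
(* Both paths up to [z] are then single edges, so [a = z = b]. *)
have [p1E q1E] := acyclic_disjoint_paths sym_e acy sP tP sU tU disj.
by move: pE qE neq_ab; rewrite p1E q1E => -[-> _] [-> _]; rewrite eqxx.
Qed.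

(** * Distances and shortest paths *)

Lemma graph_dist_le (T : finType) (e : rel T) (x : T) (s : seq T) :
  path e x s -> (graph_dist e x (last x s) <= size s)%N.
Proof.
move=> sP; rewrite /graph_dist; set a := fun n => _.
(* Walks too long for the search range are harmless: [find] returns at most the length [#|T|] of the
   list. *)
have [ltsT|leTs] := ltnP (size s) #|T|; last first.
  by apply: leq_trans leTs; rewrite -[#|T| in leqRHS](size_iota 0) find_size.
rewrite leqNgt; apply/negP => /(before_find 0%N); rewrite nth_iota // add0n.
by rewrite /a => /existsP[]; exists (in_tuple s); rewrite /= sP eqxx.
Qed.

Lemma geodesic (T : finType) (e : rel T) (x y : T) :
  connect e x y ->
  exists s, [/\ path e x s, last x s = y, uniq (x :: s)
    & size s = graph_dist e x y].
Proof.
move=> /connectP[s0 s0P {y}->]; case/shortenP: s0P => s1 s1P s1U _.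
move yE: (last x s1) => y; pose a n :=
  [exists s : n.-tuple T, path e x s && (last x s == y)].
have has_a : has a (iota 0 #|T|).
  apply/hasP; exists (size s1); last first.
    by apply/existsP; exists (in_tuple s1); rewrite /= s1P yE eqxx.
  by rewrite mem_iota add0n /= -/(size (x :: s1)) -(card_uniqP s1U) max_card.
have := nth_find 0%N has_a.
rewrite nth_iota ?add0n; last by rewrite -[ltnRHS](size_iota 0) -has_find.
case/existsP=> s /andP[sP /eqP lastE].
have size_s : size s = graph_dist e x y by rewrite size_tuple.
move: (tval s) sP lastE size_s => {s has_a a yE s1P s1U s1} t tP lastE size_t.
(* The walk found may be replaced by a simple one on some of its vertices: this is no longer, and by
   minimality no shorter. *)
rewrite -lastE in size_t *; case/shortenP: tP size_t => t' t'P t'U t't size_t.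
exists t'; split=> //; apply/eqP; rewrite eqn_leq graph_dist_le // andbT.
by rewrite -size_t; apply: uniq_leq_size t't; case/andP: t'U.
Qed.

Lemma graph_dist_edge (T : finType) (e : rel T) (x u v : T) :
  connect e x u -> e u v -> (graph_dist e x v <= (graph_dist e x u).+1)%N.
Proof.
move=> /geodesic[s [sP <- _ <-]] euv.
have := @graph_dist_le _ e x (rcons s v).
by rewrite last_rcons size_rcons rcons_path sP; apply.
Qed.

Lemma graph_dist0 (T : finType) (e : rel T) (x y : T) :
  connect e x y -> (graph_dist e x y == 0%N) = (y == x).
Proof.
move=> /geodesic[s [_ yE _ sE]]; apply/eqP/eqP=> [d0|->].
  by move: yE; rewrite (size0nil (etrans sE d0)).
by apply/eqP; rewrite -leqn0 (@graph_dist_le _ e x [::]).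
Qed.

(** * Parents and children in a rooted tree *)

Section Tree.
Variables (T : finType) (e : rel T) (r : T).
Hypothesis treeT : tree e.

Local Notation dist := (graph_dist e r).

Let sym_e : symmetric e. Proof. by case: treeT => -[]. Qed.
Let irr_e : irreflexive e. Proof. by case: treeT => -[]. Qed.
Let conn_e x : connect e r x. Proof. by case: treeT. Qed.
Let acy_e : acyclic_graph e. Proof. by case: treeT. Qed.

(** If [v] lay on the geodesic to [u], the part up to [v] would already have length at least
    [dist u], forcing [v = u]. *)
Lemma simple_path_via u v : e u v -> (dist u <= dist v)%N ->
  exists s, [/\ path e r (rcons s v), uniq (r :: rcons s v), last r s = u
    & size s = dist u].
Proof.
move=> euv le_uv; have [s [sP uE sU size_s]] := geodesic (conn_e u).
exists s; split=> //; first by rewrite rcons_path sP uE.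
suff: v \notin r :: s by rewrite -rcons_cons rcons_uniq => ->.
apply/negP=> /splitPl vs; case: vs size_s sP uE {sU} => p1 p2 vE size_s.
rewrite cat_path last_cat vE => /andP[p1P _] uE.
have := graph_dist_le p1P; rewrite vE => /(leq_trans le_uv).
rewrite -size_s size_cat -[leqRHS]addn0 leq_add2l leqn0 => /nilP p2E.
by move: uE euv; rewrite p2E => /= ->; rewrite irr_e.
Qed.

(** Otherwise a geodesic to [v] and a geodesic to [u] prolonged by [v] would be simple paths to [v]
    of different lengths. *)
Lemma tree_edge_dist u v : e u v -> dist u != dist v.
Proof.
move=> euv; apply/eqP=> uv.
have [s [sP sU _ size_s]] := simple_path_via euv (eq_leq uv).
have [t [tP tE tU size_t]] := geodesic (conn_e v).
have st := acyclic_uniq_path sym_e acy_e sP tP sU tU.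
have := congr1 size (st _); rewrite last_rcons tE size_rcons size_s size_t uv.
by move=> /(_ erefl) /eqP; rewrite eqn_leq ltnn.
Qed.

Lemma tree_child_dist u v : e u v -> (dist u < dist v)%N ->
  dist v = (dist u).+1.
Proof.
by move=> euv uv; apply/eqP; rewrite eqn_leq uv (graph_dist_edge _ euv).
Qed.

Lemma tree_parent_uniq u u' v : e u v -> e u' v ->
  (dist u < dist v)%N -> (dist u' < dist v)%N -> u = u'.
Proof.
move=> euv eu'v /ltnW uv /ltnW u'v.
have [s [sP sU <- _]] := simple_path_via euv uv.
have [t [tP tU <- _]] := simple_path_via eu'v u'v.
have := acyclic_uniq_path sym_e acy_e sP tP sU tU.
by rewrite !last_rcons => /(_ erefl) /rcons_inj[->].
Qed.

Lemma tree_parent_ex v : v != r -> exists2 u, e u v & (dist u < dist v)%N.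
Proof.
move=> vr; have [s [sP vE _ size_s]] := geodesic (conn_e v).
case/lastP: s sP vE size_s => [_ /= rv|s w]; first by rewrite rv eqxx in vr.
rewrite rcons_path last_rcons size_rcons => /andP[sP euw] wv.
by rewrite wv in euw * => <-; exists (last r s); rewrite // ltnS graph_dist_le.
Qed.

Definition children v := [set w | e v w & (dist v < dist w)%N].
Definition parents v := [set u | e u v & (dist u < dist v)%N].

Lemma card_parents v : #|parents v| = (v != r).
Proof.
have [->|vr] := eqVneq v r.
  apply/eqP; rewrite cards_eq0; apply/eqP/setP=> u; rewrite !inE.
  have /eqP-> : dist r == 0%N by rewrite graph_dist0.
  by rewrite ltn0 andbF.
have [u euv uv] := tree_parent_ex vr.
suff -> : parents v = [set u] by rewrite cards1.
apply/setP=> u'; rewrite !inE; apply/andP/eqP=> [[eu'v u'v]|->] //.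
exact: tree_parent_uniq u'v uv.
Qed.

Lemma deg_children v : deg e v = (#|children v| + (v != r))%N.
Proof.
rewrite -card_parents /deg -cardsUI.
have -> : children v :&: parents v = set0.
  apply/setP=> w; rewrite !inE andbACA ltn_neqAle leqNgt.
  by case: ltnP; rewrite ?andbF.
rewrite cards0 addn0; apply: eq_card=> w; rewrite !inE (sym_e w) -andb_orr.
by case: (boolP (e v w)) => // /tree_edge_dist; rewrite neq_ltn.
Qed.

(** Double counting of parent-child pairs: a vertex at distance [i.+1] is not the root, hence has
    exactly one parent. *)
Lemma sum_children i :
  (\sum_(v | dist v == i) #|children v|)%N = #|[set w | dist w == i.+1]|.
Proof.
under eq_bigr do rewrite -sum1_card.
rewrite (exchange_big_dep (fun w => dist w == i.+1)) /=; last first.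
  by move=> v w /eqP<-; rewrite inE => /andP[evw /(tree_child_dist evw)->].
rewrite -sum1dep_card; apply: eq_bigr=> w /eqP wE.
have wr : w != r by rewrite -(graph_dist0 (conn_e w)) wE.
rewrite -[RHS]/(nat_of_bool true) -wr -card_parents -sum1_card.
apply: eq_bigl=> v; rewrite !inE andbC; case: (boolP (e v w)) => //= evw.
apply: andb_idr=> /(tree_child_dist evw); rewrite wE => -[->]; exact: eqxx.
Qed.

(** The left side orients edges by enumeration, the right side away from [r]. Edges on which the two
    orientations disagree are matched by [swap], which symmetry of [F] permits. *)
Lemma sum_edges (R : nmodType) (F : T -> T -> R) :
  (forall u v, F u v = F v u) ->
  \sum_(uv in edges e) F uv.1 uv.2 = \sum_u \sum_(v in children u) F u v.
Proof.
move=> symF; pose swap (uv : T * T) := (uv.2, uv.1).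
rewrite pair_big_dep /= (bigID (fun uv => dist uv.1 < dist uv.2)%N) /=.
rewrite [X in _ + X](reindex_inj (inv_inj (_ : involutive swap))); last by case.
rewrite [RHS](bigID (fun uv => enum_rank uv.1 < enum_rank uv.2)%N) /=.
congr (_ + _); apply: eq_big => // -[u v] /=; rewrite !inE /=.
- by rewrite -!andbA [X in _ && X]andbC.
- rewrite (sym_e v) -!leqNgt -andbA; case: (boolP (e u v)) => //= euv.
  rewrite andbC leq_eqVlt (negPf (tree_edge_dist euv)) /=.
  congr (_ && _); rewrite [RHS]leq_eqVlt (inj_eq val_inj).
  case: eqP => // /enum_rank_inj vu.
  by rewrite vu irr_e in euv.
Qed.

End Tree.

Theorem theorem5p1 (R : realType) (T : finType) (e : rel T) (r : T)
    (k : nat) (d : nat -> nat) (p : R)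
    (hk : (2 <= k)%N)
    (hB : generalized_bethe_tree e r k)
    (hd : forall v : T, deg e v = d (tree_level e r v))
    (hdk : d k = 1%N)
    (hp : 0 < p) :
  albertson_index e p =
  (d 1%N)%:R `^ (1 / p) *
  (`|(d 1%N)%:R - (d 2%N)%:R| `^ p
   + \sum_(2 <= i < k)
       `|(d i)%:R - (d i.+1)%:R| `^ p * \prod_(2 <= j < i.+1) ((d j)%:R - 1))
  `^ (1 / p).
Proof.
have [treeT _ kE] := hB.
have conn x : connect e r x by case: treeT.
(* Depths start at 0, levels at 1: [g i] and [E i] concern the edges between the
   levels i+1 and i+2. *)
pose D := graph_dist e r.
pose g i : R := `|(d i.+1)%:R - (d i.+2)%:R| `^ p.
pose E i := (\sum_(v | D v == i) #|children e r v|)%N.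
have D_lt v : (D v < k)%N by rewrite -kE (leq_bigmax (F := tree_level e r)).
have E0 : E 0%N = d 1%N.
  rewrite /E (big_pred1 r) => [|v]; last by rewrite /= graph_dist0.
  have := deg_children r treeT r; rewrite eqxx addn0 => <-.
  rewrite hd /tree_level.
  by have /eqP-> : graph_dist e r r == 0%N by rewrite graph_dist0.
(* [E i] is also the number of vertices at depth [i.+1], each of which spends one unit of its degree
   on its parent. *)
have ES i : (E i.+1)%:R = (E i)%:R * ((d i.+2)%:R - 1) :> R.
  rewrite [E i](sum_children r treeT) mulr_natl -sumr_const natr_sum.
  apply: eq_big => [v|v /eqP vE]; first by rewrite inE.
  have := deg_children r treeT v; rewrite hd /tree_level -/(D v) vE => ->.
  by rewrite -(graph_dist0 (conn v)) -/(D v) vE natrD addrK.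
have EE i : (E i)%:R = (d 1%N)%:R * \prod_(2 <= j < i.+2) ((d j)%:R - 1) :> R.
  elim: i => [|i IHi]; first by rewrite E0 big_geq ?mulr1.
  by rewrite ES IHi [in RHS]big_nat_recr //= mulrA.
(* No vertex has depth [k]. This removes the term with [g k.-1], which involves the meaningless
   value [d k.+1]. *)
have E_last : E k.-1 = 0%N.
  rewrite [E _](sum_children r treeT) prednK ?(ltnW hk) //.
  apply/eqP; rewrite cards_eq0; apply/eqP/setP => v; rewrite !inE.
  by rewrite ltn_eqF ?D_lt.
have sumE : \sum_(uv in edges e) `|(deg e uv.1)%:R - (deg e uv.2)%:R| `^ p =
    \sum_(0 <= i < k) g i * (E i)%:R.
  rewrite (sum_edges r treeT
    (F := fun u v => `|(deg e u)%:R - (deg e v)%:R| `^ p));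
    last by move=> u v; rewrite distrC.
  rewrite big_mkord (partition_big (fun v => Ordinal (D_lt v)) predT) //=.
  apply: eq_bigr => i _; rewrite natr_sum mulr_sumr.
  apply: eq_big => [v|v /eqP/(congr1 val) /= vE]; first by rewrite -val_eqE.
  rewrite mulr_natr -[RHS]sumr_const; apply: eq_bigr => w.
  rewrite inE => /andP[evw vw].
  by rewrite !hd /tree_level (tree_child_dist treeT evw vw) -/(D v) vE.
set S := _ + _.
have {}sumE : \sum_(uv in edges e) `|(deg e uv.1)%:R - (deg e uv.2)%:R| `^ p =
    (d 1%N)%:R * S.
  rewrite sumE -(prednK (ltnW hk)) big_nat_recr //= E_last mulr0 addr0.
  have k1 : (0 < k.-1)%N by case: k hk {E_last D_lt sumE S kE hB hdk} => [|[]].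
  rewrite big_ltn // E0 mulrDr [g _ * _]mulrC.
  congr (_ + _); rewrite mulr_sumr !big_add1 /=.
  by apply: eq_bigr => i _; rewrite EE mulrCA.
rewrite /albertson_index sumE.
(* Splitting the power of the product needs [S] nonnegative, which is obtained by dividing the
   nonnegative edge sum by [d 1]. If [d 1] is zero, both sides vanish because [1 / p] is nonzero. *)
have [->|d1_neq0] := eqVneq (d 1%N) 0%N.
  by rewrite !mul0r powR0 ?mul0r // div1r invr_eq0 gt_eqF.
have d1_gt0 : 0 < (d 1%N)%:R :> R by rewrite ltr0n lt0n.
rewrite powRM ?ler0n // -(pmulr_rge0 _ d1_gt0) -sumE sumr_ge0 // => uv _.
exact: powR_ge0.
Qed.
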